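(* Let $Y = X\beta + \varepsilon$, where $X\in\mathbb{R}^{n\times p}$ is a fixed matrix, $\beta\in\mathbb{R}^p$, and $\varepsilon$ is a random vector in $\mathbb{R}^n$ following a symmetric distribution. Let $\mathrm{pen}$ be a real-valued polyhedral gauge on $\mathbb{R}^p$. If $\beta$ does not satisfy the noiseless recovery condition with respect to $X$ and $\mathrm{pen}$, then $$\mathbb{P}\left(\exists \lambda>0\ \exists \hat\beta \in S_{X,\lambda\mathrm{pen}}(Y) \text{ such that } \hat\beta \overset{\mathrm{pen}}{\sim}\beta\right) \le \frac12.$$
   Context: A prime denotes transpose. A real-valued polyhedral gauge on $\mathbb{R}^p$ is a function of the form $\mathrm{pen}(b) = \max\{u_1'b,\dots,u_k'b\}$ for some $u_1,\dots,u_k \in \mathbb{R}^p$ with $u_1 = 0$; $\partial_{\mathrm{pen}}(\beta)$ is its subdifferential at $\beta$. For $y\in\mathbb{R}^n$ and $\lambda>0$ let $S_{X,\lambda\mathrm{pen}}(y) = \mathrm{Arg}\min_{b\in\mathbb{R}^p} \frac12\|y-Xb\|_2^2 + \lambda\,\mathrm{pen}(b)$. Write $b \overset{\mathrm{pen}}{\sim} \beta$ if $\partial_{\mathrm{pen}}(b) = \partial_{\mathrm{pen}}(\beta)$. $\beta$ (or its pattern) satisfies the noiseless recovery condition with respect to $X$ and $\mathrm{pen}$ if there exist $\lambda>0$ and $\hat\beta\in S_{X,\lambda\mathrm{pen}}(X\beta)$ such that $\hat\beta\overset{\mathrm{pen}}{\sim}\beta$. A random vector $\varepsilon$ has a symmetric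 distribution if $\varepsilon$ and $-\varepsilon$ have the same distribution. *)

(* Defs.v *)
From HB Require Import structures.
From mathcomp Require Import all_boot all_order all_algebra.
From mathcomp Require Import all_classical all_reals all_analysis.

Set Implicit Arguments.
Unset Strict Implicit.
Unset Printing Implicit Defensive.

Import Order.TTheory GRing.Theory Num.Theory.
Import numFieldNormedType.Exports.

Local Open Scope classical_set_scope.
Local Open Scope ring_scope.

Definition dotcv (R : realType) (p : nat) (u v : 'cV[R]_p) : R :=
  (u^T *m v) ord0 ord0.

(* The library norm on matrices is the sup norm, hence this definition. *)
Definition l2norm (R : realType) (n : nat) (v : 'cV[R]_n) : R :=
  Num.sqrt (\sum_(i < n) v i ord0 ^+ 2).

(* There are k + 1 >= 1 vectors, and the one called u_1 on paper is u ord0.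
   Its linear form (identically 0) is the initial value of the maximum, so that
   the big operator is exactly the maximum of the k + 1 linear forms. *)
Definition polyhedral_gauge (R : realType) (p : nat)
    (pen : 'cV[R]_p -> R) : Prop :=
  exists (k : nat) (u : 'I_k.+1 -> 'cV[R]_p),
    u ord0 = 0 /\
    forall b, pen b =
      \big[Num.max/dotcv (u ord0) b]_(i < k.+1) dotcv (u i) b.

Definition subdifferential (R : realType) (p : nat) (f : 'cV[R]_p -> R)
    (b : 'cV[R]_p) : set 'cV[R]_p :=
  [set s | forall c, f b + dotcv s (c - b) <= f c].

Definition pattern_equiv (R : realType) (p : nat) (pen : 'cV[R]_p -> R)
    (b beta : 'cV[R]_p) : Prop :=
  subdifferential pen b = subdifferential pen beta.

Definition argmin (R : realType) (U : Type) (f : U -> R) : set U :=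
  [set b | forall c, f b <= f c].

Definition penalized_ls (R : realType) (n p : nat) (X : 'M[R]_(n, p))
    (lambda : R) (pen : 'cV[R]_p -> R) (y : 'cV[R]_n) : set 'cV[R]_p :=
  argmin (fun b => 2^-1 * l2norm (y - X *m b) ^+ 2 + lambda * pen b).

Definition noiseless_recovery (R : realType) (n p : nat) (X : 'M[R]_(n, p))
    (pen : 'cV[R]_p -> R) (beta : 'cV[R]_p) : Prop :=
  exists lambda : R, 0 < lambda /\
    exists bhat : 'cV[R]_p,
      penalized_ls X lambda pen (X *m beta) bhat /\
      pattern_equiv pen bhat beta.

(* R^n as a measurable space, with its Borel sigma-algebra. *)
Definition borel_cV (R : realType) (n : nat) :=
  g_sigma_algebraType (@open 'cV[R]_n).

(* Distributions are compared on Borel sets only: the value of a measure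
   outside the sigma-algebra carries no information. *)
Definition symmetric_distribution (d : measure_display) (T : measurableType d)
    (R : realType) (P : probability T R) (n : nat)
    (eps : {RV P >-> borel_cV R n}) : Prop :=
  forall B : set (borel_cV R n), measurable B ->
    distribution P eps B =
    pushforward P (fun w => - (eps w : 'cV[R]_n) : borel_cV R n) B.

(* Main.v *)
Require Import Defs.
From HB Require Import structures.
From mathcomp Require Import all_boot all_order all_algebra.
From mathcomp Require Import all_classical all_reals all_analysis.
From mathcomp Require Import ring lra.

Set Implicit Arguments.
Unset Strict Implicit.
Unset Printing Implicit Defensive.

Import Order.TTheory GRing.Theory Num.Theory.
Import numFieldNormedType.Exports.

Local Open Scope classical_set_scope.
Local Open Scope ring_scope.

(** Call an observation [y] accessible when, for some tuning parameter, the
    penalized problem at [y] has a solution with the pattern of [beta].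

    The accessible observations form a convex cone. Indeed [b] solves the
    problem at level [l > 0] exactly when [l^-1 X^T (y - X b)] is a subgradient
    of [pen] at [b], and such certificates can be rescaled and averaged because
    the subdifferential at [beta] is convex and the vectors with the pattern of
    [beta] are closed under sums and positive multiples
    ([pattern_accessibleZ], [pattern_accessibleD]). If [X beta + eps] and
    [X beta - eps] were both accessible, so would be their midpoint [X beta],
    which is the noiseless recovery condition. Failing that condition, the two
    events are disjoint; by symmetry they have the same probability, so this
    probability is at most 1/2.

    A convex cone need not be a Borel set, so measurability of the event is a
    separate matter. It holds because the accessible set is a countable union of
    closed sets ([pattern_accessible_bigcup], [closed_bounded_accessible]): it
    is the projection of a set of triples [(y, l, b)], and such a projection is
    closed once [l] and [b] range over a compact set and all conditions are
    closed. Optimality of [b] is a closed condition. Equality of patterns is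
    not, but polyhedrality makes it a countable union of closed conditions:
    subgradients at [beta] are subgradients at [b] if and only if
    [pen (beta - t b) + t pen b <= pen beta] for some [t > 0], in which case
    this holds for all small [t]
    ([subdifferential_sub_of_split], [split_of_subdifferential_sub]). *)

(** * Dot product *)

Section dot_product.
Variables (R : realType) (p : nat).
Implicit Types u v w : 'cV[R]_p.

Lemma dotcvE u v : dotcv u v = \sum_i u i ord0 * v i ord0.
Proof. by rewrite /dotcv mxE; apply: eq_bigr => i _; rewrite mxE. Qed.

Lemma dotcvC u v : dotcv u v = dotcv v u.
Proof. by rewrite !dotcvE; apply: eq_bigr => i _; rewrite mulrC. Qed.

Lemma dotcvDr u v w : dotcv u (v + w) = dotcv u v + dotcv u w.
Proof. by rewrite /dotcv mulmxDr mxE. Qed.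

Lemma dotcvDl u v w : dotcv (u + v) w = dotcv u w + dotcv v w.
Proof. by rewrite !(dotcvC _ w) dotcvDr. Qed.

Lemma dotcvZr a u v : dotcv u (a *: v) = a * dotcv u v.
Proof. by rewrite /dotcv -scalemxAr mxE. Qed.

Lemma dotcvZl a u v : dotcv (a *: u) v = a * dotcv u v.
Proof. by rewrite !(dotcvC _ v) dotcvZr. Qed.

Lemma dotcvNr u v : dotcv u (- v) = - dotcv u v.
Proof. by rewrite -scaleN1r dotcvZr mulN1r. Qed.

Lemma dotcvBr u v w : dotcv u (v - w) = dotcv u v - dotcv u w.
Proof. by rewrite dotcvDr dotcvNr. Qed.

Lemma dotcv_ge0 v : 0 <= dotcv v v.
Proof. by rewrite dotcvE sumr_ge0 // => i _; rewrite -expr2 sqr_ge0. Qed.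

Lemma l2norm_sqr v : l2norm v ^+ 2 = dotcv v v.
Proof.
rewrite /l2norm sqr_sqrtr; last by rewrite sumr_ge0 // => i _; exact: sqr_ge0.
by rewrite dotcvE.
Qed.

Lemma dotcvBB u v :
  dotcv (u - v) (u - v) = dotcv u u - 2 * dotcv u v + dotcv v v.
Proof. by rewrite !dotcvBr !(dotcvC (_ - _)) !dotcvBr (dotcvC v u); ring. Qed.

End dot_product.

Lemma dotcv_mulmx (R : realType) (n p : nat) (X : 'M[R]_(n, p))
    (u : 'cV[R]_n) (v : 'cV[R]_p) :
  dotcv u (X *m v) = dotcv (X^T *m u) v.
Proof. by rewrite /dotcv trmx_mul trmxK mulmxA. Qed.

(** * Polyhedral gauges and their subdifferentials *)

Section gauge.
Variables (R : realType) (p : nat) (pen : 'cV[R]_p -> R).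
Hypothesis hpen : polyhedral_gauge pen.
Implicit Types (b c s : 'cV[R]_p) (t : R).

Lemma gauge_max_linear : exists (k : nat) (u : 'I_k -> 'cV[R]_p),
  (forall i b, dotcv (u i) b <= pen b) /\
  (forall b, exists i, pen b = dotcv (u i) b).
Proof.
have [k [u [_ penE]]] := hpen; exists k.+1, u; split => [i b|b].
  by rewrite penE; exact: (le_bigmax _ (fun j => dotcv (u j) b)).
rewrite penE; elim/big_ind: _ => [|x y [i ->] [j ->]|i _].
- by exists ord0.
- by rewrite maxEle; case: ifP => _; [exists j|exists i].
- by exists i.
Qed.

Lemma gaugeD b c : pen (b + c) <= pen b + pen c.
Proof.
have [k [u [ub attain]]] := gauge_max_linear.
by have [i ->] := attain (b + c); rewrite dotcvDr lerD.
Qed.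

Lemma gaugeZ t b : 0 <= t -> pen (t *: b) = t * pen b.
Proof.
move=> t0; have [k [u [ub attain]]] := gauge_max_linear.
apply/le_anti/andP; split.
  by have [i ->] := attain (t *: b); rewrite dotcvZr ler_wpM2l.
by have [i ->] := attain b; rewrite -dotcvZr.
Qed.

(** For a gauge, testing the subgradient inequality along the ray through [b]
    forces equality there, which removes the base point from the inequality. *)
Lemma subdifferential_gauge b s :
  subdifferential pen b s <->
  (forall c, dotcv s c <= pen c) /\ dotcv s b = pen b.
Proof.
split=> [sb|[sle sb] c]; last by rewrite dotcvBr sb addrC subrK.
have pen0 : pen 0 = 0 by rewrite -(scale0r (0 : 'cV[R]_p)) gaugeZ // mul0r.
have E : dotcv s b = pen b.
  have := sb 0; have := sb (2 *: b).
  rewrite pen0 gaugeZ // !dotcvBr dotcvZr.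
  have -> : dotcv s 0 = 0 by rewrite -(scale0r (0 : 'cV[R]_p)) dotcvZr mul0r.
  lra.
split=> // c; have := sb c; rewrite dotcvBr E; lra.
Qed.

Lemma subdifferentialZ t b : 0 < t ->
  subdifferential pen (t *: b) = subdifferential pen b.
Proof.
move=> t0; apply/seteqP; split => s /subdifferential_gauge [sle sb];
  apply/subdifferential_gauge; split=> //.
- by apply: (mulfI (lt0r_neq0 t0)); rewrite -dotcvZr sb gaugeZ // ltW.
- by rewrite dotcvZr sb gaugeZ // ltW.
Qed.

Lemma pattern_equivZ t b beta : 0 < t ->
  pattern_equiv pen b beta -> pattern_equiv pen (t *: b) beta.
Proof. by move=> t0 h; rewrite /pattern_equiv subdifferentialZ. Qed.

(** A common subgradient of [b1] and [b2] makes the gauge additive on them; then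
    a subgradient at the sum has no slack left at either of them. *)
Lemma pattern_equivD b1 b2 beta :
  pattern_equiv pen b1 beta -> pattern_equiv pen b2 beta ->
  pattern_equiv pen (b1 + b2) beta.
Proof.
rewrite /pattern_equiv => h1 h2.
have [k [u [ub attain]]] := gauge_max_linear.
have penD : pen (b1 + b2) = pen b1 + pen b2.
  apply/le_anti; rewrite gaugeD /=.
  have [i ui] := attain b1.
  have /subdifferential_gauge[_ <-] : subdifferential pen b2 (u i).
    by rewrite h2 -h1; apply/subdifferential_gauge; split.
  by rewrite ui -dotcvDr.
rewrite -h1; apply/seteqP; split => s /[dup] s1 /subdifferential_gauge[sle sb].
  apply/subdifferential_gauge; split=> //.
  have := sle b1; have := sle b2.
  by move: sb; rewrite dotcvDr penD; lra.
have : subdifferential pen b2 s by rewrite h2 -h1.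
move=> /subdifferential_gauge[_ sb2].
by apply/subdifferential_gauge; split; rewrite // dotcvDr penD sb sb2.
Qed.

Lemma subdifferential_convex b s1 s2 t : 0 <= t <= 1 ->
  subdifferential pen b s1 -> subdifferential pen b s2 ->
  subdifferential pen b (t *: s1 + (1 - t) *: s2).
Proof.
move=> t01 h1 h2 c; have := h1 c; have := h2 c.
rewrite dotcvDl !dotcvZl; move: (dotcv s1 _) (dotcv s2 _) => x y hy hx.
nra.
Qed.

(** If [pen] splits additively along [beta = (beta - t b) + t b], a subgradient
    at [beta] has no slack at [b]. *)
Lemma subdifferential_sub_of_split t b beta : 0 < t ->
  pen (beta - t *: b) + t * pen b <= pen beta ->
  subdifferential pen beta `<=` subdifferential pen b.
Proof.
move=> t0 hsplit s /subdifferential_gauge[sle sb].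
apply/subdifferential_gauge; split=> //.
have := sle (beta - t *: b); rewrite dotcvBr dotcvZr sb => h.
have := sle b => hb.
apply/le_anti; rewrite hb /= -(ler_pM2l t0); lra.
Qed.

(** Linear forms that are active at [beta] are subgradients there, hence active
    at [b]; the inactive ones have a gap at [beta] that a small step keeps. *)
Lemma split_of_subdifferential_sub b beta :
  subdifferential pen beta `<=` subdifferential pen b ->
  \forall t \near 0^'+, pen (beta - t *: b) + t * pen b <= pen beta.
Proof.
move=> hsub; have [k [u [ub attain]]] := gauge_max_linear.
have H i : \forall t \near 0^'+,
    dotcv (u i) (beta - t *: b) <= pen beta - t * pen b.
  have [ui|ui] := eqVneq (dotcv (u i) beta) (pen beta).
    have /subdifferential_gauge[_ tight] : subdifferential pen b (u i).
      by apply: hsub; apply/subdifferential_gauge; split.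
    by near=> t; rewrite dotcvBr dotcvZr ui tight.
  have gap : 0 < pen beta - dotcv (u i) beta.
    by rewrite subr_gt0 lt_neqAle ui ub.
  (* The 1 makes the divisor below positive even if [u i] is active at [b]. *)
  have gapb : 0 < pen b - dotcv (u i) b + 1.
    by rewrite ltr_wpDl // subr_ge0 ub.
  near=> t.
  have t0 : 0 < t by [].
  have : t <= (pen beta - dotcv (u i) beta) / (pen b - dotcv (u i) b + 1).
    by near: t; apply: nbhs_right_le; rewrite divr_gt0.
  by rewrite ler_pdivlMr // dotcvBr dotcvZr; nra.
have : \forall t \near 0^'+, forall i,
    dotcv (u i) (beta - t *: b) <= pen beta - t * pen b.
  exact: filter_forall.
apply: filterS => t Ht; have [i ->] := attain (beta - t *: b).
by rewrite -lerBrDr.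
Unshelve. all: by end_near. Qed.

End gauge.

(** * First-order optimality and the cone of accessible observations *)

(** Dividing by [t] and letting [t] tend to 0 is how optimality on a segment
    becomes a first-order condition. *)
Lemma linear_term_ge0 (R : realType) (a q : R) :
  (forall t : R, 0 < t <= 1 -> 0 <= t * (a + t * q)) -> 0 <= a.
Proof.
move=> h; rewrite leNgt; apply/negP => a0.
(* With this step, t * |q| equals t * a - a, so a + t * q <= t * a < 0. *)
pose t := - a / (`|q| - a).
have d0 : 0 < `|q| - a by have := normr_ge0 q; lra.
have t0 : 0 < t by rewrite divr_gt0 // oppr_gt0.
have tE : t * (`|q| - a) = - a by rewrite mulfVK // lt0r_neq0.
have t1 : t <= 1 by rewrite ler_pdivrMr // mul1r; have := normr_ge0 q; lra.
have := h t; rewrite t0 t1 pmulr_rge0 // => /(_ isT).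
have := ler_norm q; nra.
Qed.

Section penalized_least_squares.
Variables (R : realType) (n p : nat) (X : 'M[R]_(n, p)) (pen : 'cV[R]_p -> R).
Hypothesis hpen : polyhedral_gauge pen.
Implicit Types (b c beta : 'cV[R]_p) (y : 'cV[R]_n) (l t : R).

(** The quadratic part of the objective is its linearization at [b] plus a
    nonnegative second-order term: the former alone decides optimality, since
    along a segment the latter is of order [t ^+ 2]. *)
Lemma penalized_ls_subdifferential l y b : 0 < l ->
  penalized_ls X l pen y b <->
  subdifferential pen b (l^-1 *: (X^T *m (y - X *m b))).
Proof.
move=> l0.
pose g c := l * (pen c - pen b) - dotcv (X^T *m (y - X *m b)) (c - b).
have subE : subdifferential pen b (l^-1 *: (X^T *m (y - X *m b))) <->
    forall c, 0 <= g c.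
  have clear x c : (pen b + l^-1 * x <= pen c) = (l * pen b + x <= l * pen c).
    by rewrite -(ler_pM2l l0) mulrDr mulVKf // lt0r_neq0.
  by split=> h c; have := h c; rewrite /g /= dotcvZl clear; lra.
have objE c : 2^-1 * l2norm (y - X *m c) ^+ 2 + l * pen c =
    2^-1 * l2norm (y - X *m b) ^+ 2 + l * pen b +
    (g c + 2^-1 * dotcv (X *m (c - b)) (X *m (c - b))).
  have -> : y - X *m c = (y - X *m b) - X *m (c - b).
    by rewrite mulmxBr opprB addrA subrK.
  by rewrite !l2norm_sqr dotcvBB dotcv_mulmx /g; field.
split=> [bmin|/subE h c]; last first.
  by rewrite (objE c) lerDl addr_ge0 // mulr_ge0 // ?invr_ge0 // dotcv_ge0.
apply/subE => c; apply:
  (@linear_term_ge0 _ _ (2^-1 * dotcv (X *m (c - b)) (X *m (c - b)))).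
move=> t /andP[t0 t1].
have := bmin (b + t *: (c - b)).
rewrite (objE (b + _)) lerDl => /le_trans; apply.
have -> : b + t *: (c - b) - b = t *: (c - b) by rewrite addrC addKr.
rewrite -scalemxAr dotcvZr dotcvZl.
have convt : pen (b + t *: (c - b)) - pen b <= t * (pen c - pen b).
  have -> : b + t *: (c - b) = (1 - t) *: b + t *: c.
    by rewrite scalerBr scalerBl scale1r addrAC addrA.
  apply: le_trans (lerB (gaugeD hpen _ _) (lexx _)) _.
  by rewrite (gaugeZ hpen b) ?subr_ge0 // (gaugeZ hpen c (ltW t0)); lra.
rewrite /g.
have -> : b + t *: (c - b) - b = t *: (c - b) by rewrite addrC addKr.
rewrite dotcvZr; move: convt; rewrite -(ler_pM2l l0); lra.
Qed.

Definition pattern_accessible beta y := exists l, 0 < l /\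
  exists b, penalized_ls X l pen y b /\ pattern_equiv pen b beta.

(** Scaling [y], [l] and [b] together leaves the subgradient certificate
    unchanged. *)
Lemma pattern_accessibleZ beta y t : 0 < t ->
  pattern_accessible beta y -> pattern_accessible beta (t *: y).
Proof.
move=> t0 [l [l0 [b [/penalized_ls_subdifferential hb bbeta]]]].
have tl0 : 0 < t * l by rewrite mulr_gt0.
exists (t * l); split=> //; exists (t *: b); split; last exact: pattern_equivZ.
apply/penalized_ls_subdifferential => //; rewrite subdifferentialZ //.
rewrite -scalemxAr -scalerBr -scalemxAr scalerA invfM mulrAC.
by rewrite mulVf ?lt0r_neq0 // mul1r; exact: hb.
Qed.

(** The subgradient certificate of the sum, at level [l1 + l2], is the convex
    combination of the two certificates with weights proportional to the
    levels. *)
Lemma pattern_accessibleD beta y1 y2 :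
  pattern_accessible beta y1 -> pattern_accessible beta y2 ->
  pattern_accessible beta (y1 + y2).
Proof.
move=> [l1 [l10 [b1 [/(penalized_ls_subdifferential _ _ l10) h1 b1b]]]].
move=> [l2 [l20 [b2 [/(penalized_ls_subdifferential _ _ l20) h2 b2b]]]].
have l0 : 0 < l1 + l2 by rewrite addr_gt0.
exists (l1 + l2); split=> //; exists (b1 + b2).
have bb := pattern_equivD hpen b1b b2b.
split=> //; apply/penalized_ls_subdifferential => //.
rewrite bb; rewrite b1b in h1; rewrite b2b in h2.
have t01 : 0 <= l1 / (l1 + l2) <= 1.
  by rewrite (divr_ge0 (ltW l10) (ltW l0)) /= ler_pdivrMr // mul1r lerDl ltW.
have := subdifferential_convex t01 h1 h2.
rewrite !scalerA.
have -> : l1 / (l1 + l2) / l1 = (l1 + l2)^-1 by field; rewrite !lt0r_neq0.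
have -> : (1 - l1 / (l1 + l2)) / l2 = (l1 + l2)^-1.
  by field; rewrite !lt0r_neq0.
by rewrite -scalerDr -mulmxDr addrACA -opprD -mulmxDr.
Qed.

End penalized_least_squares.

(** * Measurability of the cone of accessible observations *)

Section continuity.
Variables (R : realType) (T : topologicalType).

Lemma closed_le_fun (f g : T -> R) : continuous f -> continuous g ->
  closed [set x | f x <= g x].
Proof.
move=> cf cg.
have -> : [set x | f x <= g x] = (fun x => g x - f x) @^-1` [set z | 0 <= z].
  by apply/seteqP; split=> x /=; rewrite subr_ge0.
apply: preimage_closed; last exact: closed_ge.
by move=> x _; exact: (continuousB (cg x) (cf x)).
Qed.

Lemma continuous_mx m n (f : T -> 'M[R]_(m, n)) :
  (forall i j, continuous (fun x => f x i j)) -> continuous f.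
Proof.
move=> cf x; apply/cvg_ballP => e e0.
have H (ij : 'I_m * 'I_n) :
    \forall z \near x, ball (f x ij.1 ij.2) e (f z ij.1 ij.2).
  exact: ((cvg_ballP _ _).1 (cf ij.1 ij.2 x) e e0).
near=> z; split=> // i j.
have hz : forall ij : 'I_m * 'I_n, ball (f x ij.1 ij.2) e (f z ij.1 ij.2).
  by near: z; exact: filter_forall.
exact: hz (i, j).
Unshelve. all: by end_near. Qed.

Lemma continuous_coord m n (f : T -> 'M[R]_(m, n)) i j :
  continuous f -> continuous (fun x => f x i j).
Proof.
by move=> cf x; exact: (continuous_comp (cf x) (@coord_continuous _ _ _ i j _)).
Qed.

Lemma continuous_mulmx m n k (f : T -> 'M[R]_(m, n)) (g : T -> 'M[R]_(n, k)) :
  continuous f -> continuous g -> continuous (fun x => f x *m g x).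
Proof.
move=> cf cg; apply: continuous_mx => i j.
rewrite (_ : (fun x => _) = (fun x => \sum_l f x i l * g x l j)); last first.
  by apply/funext => x; rewrite mxE.
apply: continuous_big => [|l _ x]; first exact: add_continuous.
by apply: continuousM; exact: continuous_coord.
Qed.

Lemma continuous_trmx m n (f : T -> 'M[R]_(m, n)) :
  continuous f -> continuous (fun x => (f x)^T).
Proof.
move=> cf; apply: continuous_mx => i j.
rewrite (_ : (fun x => _) = (fun x => f x j i)); first exact: continuous_coord.
by apply/funext => x; rewrite mxE.
Qed.

Lemma continuous_dotcv p (f g : T -> 'cV[R]_p) :
  continuous f -> continuous g -> continuous (fun x => dotcv (f x) (g x)).
Proof.
move=> cf cg; apply: continuous_coord; apply: continuous_mulmx => //.
exact: continuous_trmx.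
Qed.

Lemma continuous_gauge p (pen : 'cV[R]_p -> R) (f : T -> 'cV[R]_p) :
  polyhedral_gauge pen -> continuous f -> continuous (fun x => pen (f x)).
Proof.
move=> [k [u [u0 penE]]] cf.
rewrite (_ : (fun x => _) =
    (fun x => \big[Num.max/0]_i dotcv (u i) (f x))); last first.
  by apply/funext => x; rewrite penE u0 [X in \big[_/X]_(_ < _) _]dotcvE big1 //
     => i _; rewrite mxE mul0r.
apply: continuous_big => [|i _]; first exact: max_continuous.
by apply: continuous_dotcv => // x; exact: cvg_cst.
Qed.

End continuity.

(** Projecting a closed set along a compact factor is a closed map; this is the
    tube lemma, read off the covering form of compactness. *)
Lemma closed_proj_compact (U V : topologicalType) (K : set V)
    (F : set (U * V)) :
  compact K -> closed F -> closed [set y | exists2 k, K k & F (y, k)].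
Proof.
move=> cK cF; rewrite -openC openE => y /= nF.
have : \forall z \near y, K `<=` [set k | ~ F (z, k)].
  apply: (iffLR (compact_near_coveringP K) cK _ (nbhs y)
    (fun z k => ~ F (z, k))).
  move=> k Kk.
  have : nbhs (y, k) (~` F).
    apply: open_nbhs_nbhs; split; first exact: closed_openC.
    by move=> Fyk; apply: nF; exists k.
  move=> [[A B] [/= yA kB] AB]; exists (B, A) => // -[k' z] /= [Bk Az].
  exact: AB (z, k') _.
by apply: filterS => z hz [k /hz].
Qed.

Lemma borel_cV_closed (R : realType) (n : nat) (A : set 'cV[R]_n) :
  closed A -> measurable (A : set (borel_cV R n)).
Proof.
move=> cA; rewrite -[X in measurable X]setCK; apply: measurableC.
by apply: sub_sigma_algebra; exact: closed_openC.
Qed.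

Section measurability.
Variables (R : realType) (n p : nat) (X : 'M[R]_(n, p)) (pen : 'cV[R]_p -> R).
Hypothesis hpen : polyhedral_gauge pen.
Variable beta : 'cV[R]_p.

(** For [t >= 0] subadditivity gives the converse inequality, so this says that
    [pen] is additive on [b = (b - t c) + t c]. *)
Definition splits (t : R) (b c : 'cV[R]_p) :=
  pen (b - t *: c) + t * pen c <= pen b.

(** One index [m] bounds [l] away from 0 and infinity, bounds [b], and fixes the
    step that witnesses equality of patterns. Candidates [b] are transposed
    row vectors so that [rV_compact] makes their box compact. *)
Definition bounded_accessible (m : nat) : set 'cV[R]_n :=
  [set y | exists2 k : R * 'rV[R]_p,
     (`[m.+1%:R^-1, m.+1%:R] `*`
        [set v : 'rV[R]_p | forall i, v ord0 i \in `[- m.+1%:R, m.+1%:R]]) k &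
     penalized_ls X k.1 pen y k.2^T /\
     splits m.+1%:R^-1 beta k.2^T /\ splits m.+1%:R^-1 k.2^T beta].

Lemma closed_bounded_accessible m : closed (bounded_accessible m).
Proof.
apply: (@closed_proj_compact _ _ _ [set z : 'cV[R]_n * (R * 'rV[R]_p) |
  penalized_ls X z.2.1 pen z.1 z.2.2^T /\
     splits m.+1%:R^-1 beta z.2.2^T /\ splits m.+1%:R^-1 z.2.2^T beta]).
  apply: compact_setX; first exact: segment_compact.
  exact: (@rV_compact R p (fun=> `[- m.+1%:R, m.+1%:R]%classic)
    (fun=> @segment_compact R _ _)).
pose Z : topologicalType := ('cV[R]_n * (R * 'rV[R]_p))%type.
have cy : continuous (fun z : Z => z.1).
  by move=> z; exact: cvg_fst.
have cl : continuous (fun z : Z => z.2.1).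
  by move=> z; apply: (@continuous_comp _ _ _ snd fst);
    [exact: cvg_snd|exact: cvg_fst].
have cb : continuous (fun z : Z => z.2.2^T).
  apply: continuous_trmx => z.
  by apply: (@continuous_comp _ _ _ snd snd); [exact: cvg_snd|exact: cvg_snd].
have cst (U V : topologicalType) (a : V) : continuous (fun _ : U => a).
  by move=> z; exact: cvg_cst.
have addc (f g : Z -> R) : continuous f -> continuous g ->
    continuous (fun z => f z + g z).
  by move=> cf cg z; exact: (continuousD (cf z) (cg z)).
have mulc (f g : Z -> R) : continuous f -> continuous g ->
    continuous (fun z => f z * g z).
  by move=> cf cg z; exact: (continuousM (cf z) (cg z)).
have subc k (f g : Z -> 'cV[R]_k) : continuous f -> continuous g ->
    continuous (fun z => f z - g z).
  by move=> cf cg z; exact: (continuousB (cf z) (cg z)).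
have scalec k (a : R) (f : Z -> 'cV[R]_k) : continuous f ->
    continuous (fun z => a *: f z).
  by move=> cf z; exact: (continuousZr (cf z)).
have penc (f : Z -> 'cV[R]_p) : continuous f -> continuous (fun z => pen (f z)).
  exact: continuous_gauge.
have objc (f : Z -> 'cV[R]_p) : continuous f ->
    continuous (fun z : Z => 2^-1 * l2norm (z.1 - X *m f z) ^+ 2 +
                             z.2.1 * pen (f z)).
  move=> cf; apply: addc; apply: mulc; [exact: cst| |exact: cl|exact: penc].
  rewrite (_ : (fun z => _) =
      (fun z : Z => dotcv (z.1 - X *m f z) (z.1 - X *m f z))); last first.
    by apply/funext => ?; rewrite l2norm_sqr.
  by apply: continuous_dotcv; apply: subc => //;
    apply: continuous_mulmx => //; exact: cst.
apply: closedI; last apply: closedI.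
(* Optimality is an intersection of closed conditions over all competitors. *)
- rewrite [Y in closed Y](_ : _ = \bigcap_(c in [set: 'cV[R]_p])
    [set z : Z |
      2^-1 * l2norm (z.1 - X *m z.2.2^T) ^+ 2 + z.2.1 * pen z.2.2^T <=
      2^-1 * l2norm (z.1 - X *m c) ^+ 2 + z.2.1 * pen c]); last first.
    by apply/seteqP; split=> z /= h c; [move=> _|]; exact: h.
  apply: closed_bigI => c _; apply: closed_le_fun; last first.
    by apply: objc; exact: cst.
  exact: objc.
- apply: closed_le_fun; last exact: cst.
  apply: addc; last by apply: mulc; [exact: cst|exact: penc].
  by apply: penc; apply: subc; [exact: cst|exact: scalec].
- apply: closed_le_fun; last exact: penc.
  by apply: addc; [apply: penc; apply: subc => //|]; exact: cst.
Qed.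

(** The splitting conditions hold at every small enough step, so that all the
    constraints are met at once for large [m]. *)
Lemma pattern_accessible_bigcup :
  pattern_accessible X pen beta = \bigcup_m bounded_accessible m.
Proof.
apply/seteqP; split=> y; last first.
  move=> [m _ [[l v] [/= + _] [ls [s1 s2]]]].
  rewrite in_itv /= => /andP[ml _].
  have m0 : 0 < m.+1%:R^-1 :> R by rewrite invr_gt0.
  exists l; split; first exact: lt_le_trans ml.
  exists v^T; split=> //; apply/seteqP; split.
    exact: (subdifferential_sub_of_split hpen m0 s2).
  exact: (subdifferential_sub_of_split hpen m0 s1).
move=> [l [l0 [b [ls bbeta]]]].
have inv0 : m.+1%:R^-1 @[m --> \oo] --> (0 : R)^'+.
  move=> A [e /= e0 eA]; have := near_infty_natSinv_lt (PosNum e0).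
  apply: filterS => m me; apply: eA => /=; last by rewrite invr_gt0.
  by rewrite sub0r normrN ger0_norm.
have s1 : \forall m \near \oo, splits m.+1%:R^-1 beta b.
  have hsub : subdifferential pen beta `<=` subdifferential pen b.
    by rewrite bbeta.
  exact: (inv0 _ (split_of_subdifferential_sub hpen hsub)).
have s2 : \forall m \near \oo, splits m.+1%:R^-1 b beta.
  have hsub : subdifferential pen b `<=` subdifferential pen beta.
    by rewrite bbeta.
  exact: (inv0 _ (split_of_subdifferential_sub hpen hsub)).
have large (a : R) : \forall m \near \oo, a <= m.+1%:R.
  by near=> m; rewrite (@le_trans _ _ m%:R) ?ler_nat //; near: m;
    exact: nbhs_infty_ger.
have small : \forall m \near \oo, m.+1%:R^-1 <= l.
  exact: (inv0 _ (nbhs_right_le l0)).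
have box : \forall m \near \oo, forall i, `|b i ord0| <= m.+1%:R.
  by apply: filter_forall => i; exact: large.
near \oo => m.
exists m => //; exists (l, b^T); rewrite /= ?trmxK.
  split=> /=.
    by rewrite in_itv /=; apply/andP; split; near: m.
  move=> i; rewrite in_itv /= -ler_norml mxE.
  by move: i; near: m.
by split=> //; split; near: m.
Unshelve. all: by end_near. Qed.

Lemma measurable_preimage_pattern_accessible m (f : 'cV[R]_m -> 'cV[R]_n) :
  continuous f ->
  measurable (f @^-1` pattern_accessible X pen beta : set (borel_cV R m)).
Proof.
move=> cf; rewrite pattern_accessible_bigcup preimage_bigcup.
apply: bigcup_measurable => i _; apply: borel_cV_closed.
apply: preimage_closed; first by move=> z _; exact: cf.
exact: closed_bounded_accessible.
Qed.

End measurability.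

(** * The probability bound *)

Lemma probability_le_half (R : realType) (d : measure_display)
    (T : measurableType d) (P : probability T R) (A B : set T) :
  measurable A -> measurable B -> A `&` B = set0 -> P A = P B ->
  (P A <= (1 / 2)%:E)%E.
Proof.
move=> mA mB AB PAB.
have : (P (A `|` B) <= 1)%E by apply: probability_le1; exact: measurableU.
have -> : P (A `|` B) = (P A + P A)%E.
  by rewrite {2}PAB; exact: (measureU P mA mB AB).
have /fineK <- : P A \is a fin_num by exact: fin_num_measure.
rewrite -EFinD !lee_fin; lra.
Qed.

Theorem theorem4p6 (R : realType) (d : measure_display) (T : measurableType d)
    (P : probability T R) (n p : nat) (X : 'M[R]_(n, p)) (beta : 'cV[R]_p)
    (eps : {RV P >-> borel_cV R n}) (Y : T -> 'cV[R]_n)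
    (pen : 'cV[R]_p -> R)
    (hY : forall w, Y w = X *m beta + (eps w : 'cV[R]_n))
    (heps : symmetric_distribution eps)
    (hpen : polyhedral_gauge pen)
    (hbeta : ~ noiseless_recovery X pen beta) :
  let E := [set w | exists lambda : R, 0 < lambda /\
              exists bhat : 'cV[R]_p,
                penalized_ls X lambda pen (Y w) bhat /\
                pattern_equiv pen bhat beta] in
  measurable E /\ (P E <= (1 / 2)%:E)%E.
Proof.
move=> E.
(* The two events to compare are those of s = 1 and s = -1. *)
pose shift (s : R) (z : 'cV[R]_n) := X *m beta + s *: z.
pose B s : set (borel_cV R n) := shift s @^-1` pattern_accessible X pen beta.
have mB s : measurable (B s).
  apply: measurable_preimage_pattern_accessible => // z.
  exact: (continuousD (@cst_continuous _ _ _ _) (@scaler_continuous _ _ _ _)).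
have mpre s : measurable (eps @^-1` B s) by exact: measurable_funPTI.
have EB : E = eps @^-1` B 1.
  by apply/seteqP; split=> w; rewrite /E /B /shift /= scale1r -hY.
have BN : (fun w => - (eps w : 'cV[R]_n) : borel_cV R n) @^-1` B 1 =
    eps @^-1` B (-1).
  by apply/seteqP; split=> w; rewrite /B /shift /= scale1r scaleN1r.
rewrite EB; split; first exact: mpre.
apply: (probability_le_half (mpre 1) (mpre (-1))).
  apply/seteqP; split=> // w [/= h1 h2]; apply: hbeta.
  have := pattern_accessibleD hpen h1 h2.
  rewrite /shift addrACA scale1r scaleN1r subrr addr0.
  have half : 0 < 2^-1 :> R by rewrite invr_gt0.
  move=> /(pattern_accessibleZ hpen half).
  by rewrite -(mulr2n (X *m beta)) -(scaler_nat _ (X *m beta)) scalerA mulVf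
    ?scale1r ?pnatr_eq0.
by rewrite -BN; exact: heps.
Qed.
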